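(* For any configuration $G$ with $n$ nodes and span $\sigma$, if $G$ is feasible then there is a dedicated distributed leader election algorithm $(D,f)$ for $G$ in which every node terminates within $O(n^2\sigma)$ rounds.
   Context: Model. A configuration is a finite simple undirected connected graph $G$ in which each node $v$ is tagged with a non-negative integer $t_v$ (its wakeup tag); by convention the smallest tag is $0$, and the span $\sigma$ of $G$ is the largest tag. Nodes are anonymous and communicate in synchronous global rounds. A node $v$ wakes up in the first global round $r\le t_v$ in which it receives a message, if any (forced wakeup), and otherwise in global round $t_v$ (spontaneous wakeup). Its local clock is $0$ in its wakeup round; it acts from local round $1$ on, and nodes do not know the global clock. In each round a node either transmits a message to all neighbours, listens, or terminates. A listening node $v$ receives message $M$ if exactly one neighbour transmits (and it transmits $M$), hears a collision (noise, distinguishable from silence and from messages) if at least two neighbours transmit, and hears silence otherwise; a transmitting node hears nothing. The history of $v$ in local round $i\ge 0$ is $\mathcal H_v[i]=(\emptyset)$ if $v$ transmits or hears silence in local round $i$ (or $i=0$ and $v$ woke up spontaneously), $(M)$ if $v$ receives $M$ in local round $i$ (or $i=0$ and $v$ was woken by $M$), and $( * )$ if a collision occurs at a listening $v$. A DRIP (distributed radio interaction protocol) is a function $D$ mapping finite history vectors to one of $\mathit{listen}$, $\mathit{transmit}(M)$, $\mathit{terminate}$; each node $v$ in local round $i\ge1$ performs $D(\mathcal H_v[0\ldots i-1])$, and every node must eventually terminate permanently. $done_v$ is the first local round in which $v$ terminates. A decision function $f$ maps the final history $\mathcal H_v[0\ldots done_v]$ to $\{0,1\}$. A dedicated leader election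 algorithm for $G$ is a pair $(D,f)$ such that, when all nodes of $G$ execute $D$, $f$ outputs $1$ at exactly one node. $G$ is feasible if such an algorithm exists. *)

(* Defs.v *)
From mathcomp Require Import all_boot.
Set Implicit Arguments. Unset Strict Implicit. Unset Printing Implicit Defensive.

(* Messages are natural numbers (any countable message alphabet). *)
Definition message := nat.

Inductive hentry := HSilence | HMsg of message | HColl.

Inductive action := Listen | Transmit of message | Terminate.

Definition drip := seq hentry -> action.
Definition decision := seq hentry -> bool.

Inductive nstate :=
  | Asleep
  | Active of seq hentry
  | Halted of seq hentry.

Definition configuration (T : finType) (e : rel T) (t : T -> nat) : Prop :=
  symmetric e /\ irreflexive e /\ (forall x y : T, connect e x y) /\
  (exists v : T, t v = 0).

Definition span (T : finType) (t : T -> nat) : nat := \max_(v : T) t v.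

Section Exec.
Variables (T : finType) (e : rel T) (t : T -> nat) (D : drip).

Definition heard (tx : T -> option message) (v : T) : hentry :=
  match pmap (fun u => if e v u then tx u else None) (enum T) with
  | [::] => HSilence
  | [:: m] => HMsg m
  | _ => HColl
  end.

Definition transmitted (s : nstate) : option message :=
  match s with
  | Active h => if D h is Transmit m then Some m else None
  | _ => None
  end.

Definition step (r : nat) (s : T -> nstate) : T -> nstate :=
  let tx := fun u => transmitted (s u) in
  fun v =>
  match s v with
  | Asleep =>
      if r <= t v then
        match heard tx v with
        | HMsg m => Active [:: HMsg m]
        | _ => if r == t v then Active [:: HSilence]
               else Asleep
        end
      else Asleep
  | Active h =>
      match D h with
      | Listen => Active (rcons h (heard tx v))
      | Transmit _ => Active (rcons h HSilence)
      | Terminate => Halted (rcons h HSilence)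
      end
  | Halted h => Halted h
  end.

(* states r = states of all nodes after global round r (rounds 0..r). *)
Fixpoint states_before (r : nat) : T -> nstate :=
  match r with
  | 0 => fun _ => Asleep
  | r'.+1 => step r' (states_before r')
  end.

Definition states (r : nat) : T -> nstate := states_before r.+1.

Definition final_history (v : T) (h : seq hentry) : Prop :=
  exists r, states r v = Halted h.

End Exec.

(* done_v = local round of termination = size of final history - 1. *)
Definition done_round (h : seq hentry) : nat := (size h).-1.

Definition dedicated_LE (T : finType) (e : rel T) (t : T -> nat)
    (D : drip) (f : decision) : Prop :=
  (forall v : T, exists h, final_history e t D v h) /\
  (exists v : T, (exists h, final_history e t D v h /\ f h = true) /\
     forall u : T, (exists h, final_history e t D u h /\ f h = true) -> u = v).

Definition feasible (T : finType) (e : rel T) (t : T -> nat) : Prop :=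
  exists (D : drip) (f : decision), dedicated_LE e t D f.

(* Main.v *)
(* Refine the partition of the nodes in phases, starting from a single class.  In each
   phase all nodes of a class transmit at the same local time, in a block of length
   2 * span + 1 reserved for the class; a node thus learns, for every class and every
   tag difference, whether it has zero, one or several such neighbours, and what it
   hears refines its class.  Some phase p < n causes no refinement.  Classes of such a
   stable partition cannot be separated by any protocol: by induction on time, two
   nodes of the same class always are in the same state at equal distances from their
   tags, also when wakeups are forced.  Hence the leader elected by any algorithm is
   alone in its class, and p phases of n blocks suffice to single it out. *)

Require Import Defs.
From mathcomp Require Import all_boot.
From HB Require Import structures.
From mathcomp Require Import zify.
Set Implicit Arguments. Unset Strict Implicit. Unset Printing Implicit Defensive.

(** * Reception as a function of the transmitting neighbours *)

Definition code_hentry (x : hentry) : option (option nat) :=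
  match x with HSilence => None | HColl => Some None | HMsg m => Some (Some m) end.
Definition decode_hentry (x : option (option nat)) : hentry :=
  match x with None => HSilence | Some None => HColl | Some (Some m) => HMsg m end.
Lemma code_hentryK : cancel code_hentry decode_hentry. Proof. by case. Qed.
HB.instance Definition _ := Equality.copy hentry (can_type code_hentryK).

Definition merge_messages (l : seq message) : hentry :=
  match l with [::] => HSilence | [:: m] => HMsg m | _ => HColl end.

Lemma heardE (T : finType) (e : rel T) tx v :
  heard e tx v = merge_messages (pmap tx [seq w <- enum T | e v w]).
Proof.
rewrite /heard -/(merge_messages _); congr merge_messages.
elim: (enum T) => //= w s ->; by case: (e v w).
Qed.

Lemma eq_heard (T : finType) (e : rel T) tx1 tx2 v :
  {in e v, tx1 =1 tx2} -> heard e tx1 v = heard e tx2 v.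
Proof.
move=> E; rewrite !heardE; congr merge_messages.
by apply/eq_in_pmap => w; rewrite mem_filter => /andP[/E].
Qed.

Lemma heard_silent (T : finType) (e : rel T) tx v :
  {in e v, forall w, tx w = None} -> heard e tx v = HSilence.
Proof.
move=> E; rewrite (@eq_heard _ _ _ (fun=> None)) // heardE.
by elim: (filter _ _).
Qed.

Lemma heard_comp (T : finType) (e : rel T) (K : Type) (key : T -> K) M v :
  heard e (M \o key) v = merge_messages (pmap M [seq key w | w <- enum T & e v w]).
Proof. by rewrite heardE; congr merge_messages; elim: (filter _ _) => //= w s ->. Qed.

Lemma merge_indicator (K : eqType) (o : K) (A : seq K) :
  merge_messages (pmap (fun x => if x == o then Some 0 else None) A) =
  merge_messages (nseq (minn 2 (count_mem o A)) 0).
Proof.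
have -> : pmap (fun x => if x == o then Some 0 else None) A = nseq (count_mem o A) 0.
  by elim: A => //= x A ->; case: (x == o).
by case: (count_mem o A) => [|[|c]] //; rewrite (minn_idPl _).
Qed.

(** Counts capped at 2 are exact if they are at most 1, so [B] is a permutation of the short list
    [A]. *)
Lemma eq_capped_count (K : eqType) (A B : seq K) :
  (forall o, minn 2 (count_mem o A) = minn 2 (count_mem o B)) ->
  size A <= 1 -> A = B.
Proof.
move=> E sA; apply/esym/perm_small_eq => //; apply/allP => o _ /=; rewrite eq_sym.
by apply/eqP; move: (E o) (count_size (pred1 o) A); lia.
Qed.

(** Either one side has at most one transmitting entry, and then both sides have the same, or both
    give a collision. *)
Lemma eq_merge_pmap (K : eqType) (M : K -> option message) (A B : seq K) :
  (forall o, M o -> minn 2 (count_mem o A) = minn 2 (count_mem o B)) ->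
  merge_messages (pmap M A) = merge_messages (pmap M B).
Proof.
move=> E; have pmapE s : pmap M s = pmap M (filter M s).
  by elim: s => //= x s ->; case Mx: (M x) => [m|] //=; rewrite Mx.
have sizeE s : size (pmap M (filter M s)) = size (filter M s).
  rewrite size_pmap -size_filter -filter_predI.
  by congr (size _); apply: eq_filter => x /=; rewrite andbb.
have EF o : minn 2 (count_mem o (filter M A)) = minn 2 (count_mem o (filter M B)).
  rewrite !count_filter; case Mo: (isSome (M o)).
    have /= EM x : (x == o) && M x = (x == o) by case: eqP => // ->; rewrite Mo.
    by rewrite !(eq_count EM); apply: E.
  have /= EM x : (x == o) && M x = false by case: eqP => // ->; rewrite Mo.
  by rewrite !(eq_count EM) !count_pred0.
rewrite (pmapE A) (pmapE B).
case: (leqP (size (filter M A)) 1) => sA; first by rewrite (eq_capped_count EF).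
case: (leqP (size (filter M B)) 1) => sB.
  by rewrite (@eq_capped_count _ (filter M B) (filter M A)).
move: sA sB; rewrite -!sizeE.
by case: (pmap _ _) => [|? []] //; case: (pmap _ _) => [|? []].
Qed.

(** Probing a single key reveals its multiplicity among the neighbours, capped at 2. These
    multiplicities determine what is heard whenever transmissions depend on keys alone. *)
Lemma eq_heard_keys (T : finType) (e : rel T) (K : eqType) (ku kv : T -> K)
    (M : K -> option message) (u v : T) (txu txv : T -> option message) :
  {in e u, txu =1 M \o ku} -> {in e v, txv =1 M \o kv} ->
  (forall o, M o -> heard e (fun w => if ku w == o then Some 0 else None) u =
                    heard e (fun w => if kv w == o then Some 0 else None) v) ->
  heard e txu u = heard e txv v.
Proof.
move=> Eu Ev E; rewrite (eq_heard Eu) (eq_heard Ev) !heard_comp.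
apply: eq_merge_pmap => o /E.
rewrite !(heard_comp _ _ (fun x => if x == o then Some 0 else None)) !merge_indicator.
have := geq_minl 2 (count_mem o (map ku [seq w <- enum T | e u w])).
have := geq_minl 2 (count_mem o (map kv [seq w <- enum T | e v w])).
by case: (minn _ _) => [|[|[|?]]] //; case: (minn _ _) => [|[|[|?]]].
Qed.

Lemma factor_through_key (Z : finType) (K : eqType) (R : Type) (P : pred Z)
    (key : Z -> K) (val : Z -> option R) :
  {in P &, forall z1 z2, key z1 = key z2 -> val z1 = val z2} ->
  exists2 M : K -> option R, {in P, val =1 M \o key} &
    forall o, M o -> exists2 z, P z & key z = o /\ val z.
Proof.
move=> E.
exists (fun o => if [pick z | P z && (key z == o)] is Some z then val z else None).
  move=> z Pz /=; case: pickP => [z1 /andP[Pz1 /eqP k1]|/(_ z)]; first exact: E.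
  by rewrite eqxx andbT; have -> : P z by [].
by move=> o; case: pickP => // z /andP[Pz /eqP kz] vz; exists z.
Qed.

(** * Stabilisation of refining partitions *)

(* While the partition keeps being refined, the set of first elements of classes
   grows strictly, hence at most [#|T|] times. *)
Lemma stable_refinement (T : finType) (X : eqType) (g : nat -> T -> X) :
  (forall p u v, g p.+1 u = g p.+1 v -> g p u = g p v) -> 0 < #|T| ->
  exists2 p, p < #|T| & forall u v, g p u = g p v -> g p.+1 u = g p.+1 v.
Proof.
move=> gE T0.
pose first p v := [forall u, (g p u == g p v) ==> (enum_rank v <= enum_rank u)].
have firstP p v : exists2 w, first p w & g p w = g p v.
  case: (arg_minnP (fun w => enum_rank w : nat)
           (P := fun w => g p w == g p v) (eqxx _)) => w /eqP gw wmin.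
  by exists w => //; apply/forallP => u; apply/implyP; rewrite gw; apply: wmin.
have first_inj p u v : first p u -> first p v -> g p u = g p v -> u = v.
  move=> /forallP/(_ v)/implyP fu /forallP/(_ u)/implyP fv E.
  apply/enum_rank_inj/val_inj/eqP; rewrite eqn_leq.
  by rewrite fu ?E ?eqxx // fv ?E ?eqxx.
pose R p := [set v | first p v].
have inR p v : (v \in R p) = first p v by rewrite inE.
have sub p : R p \subset R p.+1.
  apply/subsetP => v; rewrite !inR => /forallP fv; apply/forallP => u.
  by apply/implyP => /eqP/gE E; apply: (implyP (fv u)); rewrite E.
have [[p lp RE]|nst] : (exists2 p, p < #|T| & R p = R p.+1) \/
    forall p, p < #|T| -> R p != R p.+1.
  case: (pickP (fun p : 'I_#|T| => R p == R p.+1)) => [p /eqP ?|no].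
    by left; exists (val p) => //; apply: ltn_ord.
  by right=> p lp; have /negbT := no (Ordinal lp).
  (* The representatives of [u] and [v] at level [p.+1] also represent their common class at level
     [p], so they coincide. *)
  exists p => // u v guv.
  have [u1 fu gu] := firstP p.+1 u; have [v1 fv gv] := firstP p.+1 v.
  rewrite -gu -gv; congr (g p.+1 _); apply: (first_inj p).
  - by rewrite -inR RE inR.
  - by rewrite -inR RE inR.
  - by rewrite (gE _ _ _ gu) (gE _ _ _ gv).
have card_gt p : p <= #|T| -> p < #|R p|.
  elim: p => [_|p IH lp].
    have [v0 _] := card_gt0P T0; have [w fw _] := firstP 0 v0.
    by apply/card_gt0P; exists w; rewrite inR.
  apply: leq_ltn_trans (IH (ltnW lp)) _; apply: proper_card.
  by rewrite properEneq nst // sub.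
by have := card_gt _ (leqnn _); rewrite ltnNge max_card.
Qed.

(** * Indistinguishability within a stable partition *)

Definition local_step (D : drip) (early now : bool) (x : hentry) (s : nstate) : nstate :=
  match s with
  | Asleep =>
      if early then
        match x with
        | HMsg m => Active [:: HMsg m]
        | _ => if now then Active [:: HSilence] else Asleep
        end
      else Asleep
  | Active h =>
      match D h with
      | Listen => Active (rcons h x)
      | Transmit _ => Active (rcons h HSilence)
      | Terminate => Halted (rcons h HSilence)
      end
  | Halted h => Halted h
  end.

Lemma stepE (T : finType) (e : rel T) (t : T -> nat) D r s v :
  step e t D r s v = local_step D (r <= t v) (r == t v)
                       (heard e (fun w => transmitted D (s w)) v) (s v).
Proof. by []. Qed.

Lemma local_step_transmit D early now x y s :
  transmitted D s -> local_step D early now x s = local_step D early now y s.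
Proof. by case: s => //= h; case: (D h). Qed.

Section ShiftInvariance.

Variables (T : finType) (e : rel T) (t : T -> nat) (D : drip).
Variables (s : nat) (slot : T -> nat).

Hypothesis tag_le : forall v, t v <= s.

(* [key u w] is the round of the phase, on the clock of [u], in which [w] transmits. *)
Let key u w := slot w + t w - t u.

Hypothesis key_inj : forall u v w w',
  key u w = key v w' -> slot w = slot w' /\ t w + t v = t w' + t u.
Hypothesis stable : forall u v, slot u = slot v -> forall o, o != slot u ->
  heard e (fun w => if key u w == o then Some 0 else None) u =
  heard e (fun w => if key v w == o then Some 0 else None) v.

(* Delaying the execution by [s] rounds makes every time shift below well defined in [nat]. *)
Let S k v := states_before e t D (k - s) v.

Let S_asleep k v : k <= s -> S k v = Asleep.
Proof. by rewrite /S -subn_eq0 => /eqP ->. Qed.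

Let S_step k v : S k.+1 v =
  local_step D (k <= t v + s) (k == t v + s) (heard e (fun w => transmitted D (S k w)) v) (S k v).
Proof.
case: (ltnP k s) => ks.
  rewrite !S_asleep ?(ltnW ks) // heard_silent => [|w _]; last by rewrite S_asleep ?(ltnW ks).
  by rewrite /= (_ : k == _ = false) ?if_same //; lia.
rewrite /S subSn //= stepE; congr local_step; lia.
Qed.

Lemma shift_invariance k k' u v :
  slot u = slot v -> k + t v = k' + t u -> S k u = S k' v.
Proof.
(* Induction on a bound for both rounds, since neighbours are compared at every pairing of [k] and
   [k']. *)
elim: {k k'}(maxn k k') {-2}k {-2}k' (leqnn (maxn k k')) u v => [|m IH] k k' km u v suv kt.
  by rewrite !S_asleep //; lia.
have tu := tag_le u; have tv := tag_le v.
case: k k' => [|k] [|k'] in km kt *; try by rewrite !S_asleep //; lia.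
have {}km : maxn k k' <= m by lia.
have ES : S k u = S k' v by apply: IH; lia.
rewrite !S_step ES.
have -> : (k <= t u + s) = (k' <= t v + s) by lia.
have -> : (k == t u + s) = (k' == t v + s) by lia.
case tx: (isSome (transmitted D (S k' v))); first exact: local_step_transmit.
congr local_step.
(* By induction, what a neighbour transmits depends only on its class and on its
   tag difference to the listener, hence only on its key. *)
pose nbr (z : bool * T) := if z.1 then e u z.2 else e v z.2.
pose zkey (z : bool * T) := if z.1 then key u z.2 else key v z.2.
pose zval (z : bool * T) := transmitted D (if z.1 then S k z.2 else S k' z.2).
have [[b1 w1] [b2 w2] _ _|M ME MP] := @factor_through_key _ _ _ nbr zkey zval.
  by case: b1 b2 => [] []; rewrite /zkey /zval /= => /key_inj[sw tw];
    congr (transmitted D _); apply: IH => //; lia.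
apply: (@eq_heard_keys _ _ _ (key u) (key v) M) => [w ew|w ew|o Mo].
- exact: (ME (true, w) ew).
- exact: (ME (false, w) ew).
(* A node with the key of [u] itself acts like [u], which does not transmit. *)
- apply: stable => //; apply/eqP => oE; subst o.
  have [[b w] _ [kz vz]] := MP _ Mo.
  case: b kz vz; rewrite /zkey /zval /= => kz vz.
    have [|sw tw] := @key_inj u u w u; first by rewrite kz /key addnK.
    by move: vz; rewrite (IH _ k' _ w v) ?tx //; lia.
  have [|sw tw] := @key_inj v v w v; first by rewrite kz /key addnK.
  by move: vz; rewrite (IH _ k' _ w v) ?tx //; lia.
Qed.

Lemma final_history_invariance u v h :
  slot u = slot v -> final_history e t D u h -> final_history e t D v h.
Proof.
move=> suv [r]; rewrite /states => H.
have tu := tag_le u; have tv := tag_le v.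
have := @shift_invariance (r.+1 + s) (r.+1 + s + t v - t u) u v suv.
rewrite /S addnK H => E; have {}E := E ltac:(lia).
by case: (_ - s) E => [|r'] // E; exists r'.
Qed.

End ShiftInvariance.

(** * The canonical protocol *)

Lemma decode_block L a x b y : x < L -> y < L -> a * L + x = b * L + y -> a = b /\ x = y.
Proof.
move=> xL yL E; have L0 : 0 < L by lia.
have := congr1 (modn^~ L) E; have := congr1 (divn^~ L) E.
by rewrite !modnMDl !divnMDl // !modn_small // !divn_small // !addn0.
Qed.

Section Canonical.

Variables (T : finType) (e : rel T) (t : T -> nat).

Definition block_length := (span t).*2.+1.
Definition phase_length := #|T| * block_length.

(* A phase has one block per class.  Tags differ by at most the span, so a
   transmission in the middle of a block is heard within the same block of the
   listener's own clock, at an offset that reveals the class and tag difference. *)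
Definition slot_of (H : T -> seq hentry) (h : seq hentry) : nat :=
  index h (map H (enum T)) * block_length + span t.

Definition phase_entry (H : T -> seq hentry) (v : T) (o : nat) : hentry :=
  if o == slot_of H (H v) then HSilence
  else heard e (fun w => if slot_of H (H w) + t w - t v == o then Some 0 else None) v.

(* The history a node will have after [p] phases of the canonical protocol; it also
   serves as the name of the node's class at that point. *)
Fixpoint trace (p : nat) (v : T) : seq hentry :=
  if p is p'.+1 then trace p' v ++ mkseq (phase_entry (trace p') v) phase_length
  else [:: HSilence].

(** A dedicated algorithm may have all traces built in. A node reads its local time off the length
    of its history, and its class off the prefix that precedes the current phase. *)
Definition canonical_drip (P : nat) : drip := fun h =>
  let p := (size h).-1 %/ phase_length in
  if P <= p then Terminate
  else if (size h).-1 %% phase_length == slot_of (trace p) (take (p * phase_length).+1 h)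
  then Transmit 0 else Listen.

Let slot p v := slot_of (trace p) (trace p v).

Lemma tag_le_span v : t v <= span t.
Proof. exact: leq_bigmax. Qed.

Lemma index_trace_lt p v : index (trace p v) (map (trace p) (enum T)) < #|T|.
Proof. by rewrite cardE -(size_map (trace p)) index_mem map_f // mem_enum. Qed.

Lemma slot_bounds p v : span t <= slot p v /\ slot p v + span t < phase_length.
Proof.
have := index_trace_lt p v; rewrite /slot /slot_of /phase_length /block_length; nia.
Qed.

Lemma phase_length_gt0 (v : T) : 0 < phase_length.
Proof. by have := slot_bounds 0 v; lia. Qed.

Lemma slot_inj p u v : slot p u = slot p v -> trace p u = trace p v.
Proof.
rewrite /slot /slot_of => /addIn/eqP; rewrite eqn_pmul2r // => /eqP E.
have mem w : trace p w \in map (trace p) (enum T) by rewrite map_f // mem_enum.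
by rewrite -(nth_index [::] (mem u)) E nth_index.
Qed.

(** Division by [block_length] recovers the class of the sender as quotient and [span t + t w - t u]
    as remainder. *)
Lemma slot_key_inj p u v w w' :
  slot p w + t w - t u = slot p w' + t w' - t v ->
  slot p w = slot p w' /\ t w + t v = t w' + t u.
Proof.
have := tag_le_span u; have := tag_le_span v.
have := tag_le_span w; have := tag_le_span w'.
rewrite /slot /slot_of; move: (index _ _) (index _ _) => j i ? ? ? ? E.
have [|||-> ?] := @decode_block block_length i (span t + t w - t u) j (span t + t w' - t v);
  rewrite /block_length in E *; lia.
Qed.

Lemma size_trace p v : size (trace p v) = (p * phase_length).+1.
Proof. by elim: p => //= p IH; rewrite size_cat IH size_mkseq; lia. Qed.

Lemma take_trace p P v : p <= P -> take (p * phase_length).+1 (trace P v) = trace p v.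
Proof.
elim: P => [|P IH]; first by rewrite leqn0 => /eqP ->.
rewrite leq_eqVlt => /predU1P[->|pP]; first by rewrite -(size_trace _ v) take_size.
rewrite /= take_cat size_trace; case: ltnP => // h; first exact: IH.
have -> : p = P by have := phase_length_gt0 v; nia.
by rewrite subnn take0 cats0.
Qed.

Lemma trace_refine p u v : trace p.+1 u = trace p.+1 v -> trace p u = trace p v.
Proof. by move=> E; rewrite -(take_trace u (leqnSn p)) E take_trace. Qed.

Lemma nth_trace p P o v : p < P -> o < phase_length ->
  nth HSilence (trace P v) (p * phase_length + o).+1 = phase_entry (trace p) v o.
Proof.
move=> pP oL; rewrite -(@nth_take (p.+1 * phase_length).+1); last by lia.
rewrite take_trace //= nth_cat size_trace ltnS ltnNge leq_addr /=.
by rewrite subSS addKn nth_mkseq.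
Qed.

(** The entries of a phase are exactly the single-key probes; beyond the phase there are no keys. *)
Lemma trace_stable p :
  (forall u v, trace p u = trace p v -> trace p.+1 u = trace p.+1 v) ->
  forall u v, slot p u = slot p v -> forall o, o != slot p u ->
  heard e (fun w => if slot p w + t w - t u == o then Some 0 else None) u =
  heard e (fun w => if slot p w + t w - t v == o then Some 0 else None) v.
Proof.
move=> st u v suv o os; case: (ltnP o phase_length) => oL.
  have := nth_trace u (ltnSn p) oL; rewrite (st u v (slot_inj suv)) nth_trace //.
  by rewrite /phase_entry -!/(slot _ _) -suv (negPf os) => ->.
by rewrite !heard_silent // => w _; case: eqP => // E;
  have := slot_bounds p w; have := tag_le_span w; lia.
Qed.

(** * Execution of the canonical protocol *)

Section Run.

Variable P : nat.
Let D := canonical_drip P.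

Lemma canonical_action p o v : p < P -> o < phase_length ->
  D (take (p * phase_length + o).+1 (trace P v)) = if o == slot p v then Transmit 0 else Listen.
Proof.
move=> pP oL; rewrite /D /canonical_drip size_takel ?size_trace; last by nia.
rewrite /= divnMDl ?modnMDl ?(phase_length_gt0 v) // divn_small // modn_small // addn0.
rewrite leqNgt pP /= take_takel; last by lia.
by rewrite take_trace // ltnW.
Qed.

Lemma canonical_terminates v : D (trace P v) = Terminate.
Proof.
by rewrite /D /canonical_drip size_trace /= mulnK ?(phase_length_gt0 v) // leqnn.
Qed.

(** No wakeup is forced, so before global round [r] an active [v] has a history of length
    [r - t v]. *)
Definition predicted (r : nat) (v : T) : nstate :=
  if r <= t v then Asleep
  else if r - t v <= (P * phase_length).+1 then Active (take (r - t v) (trace P v))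
  else Halted (rcons (trace P v) HSilence).

Lemma predicted_asleep r v : r <= t v -> predicted r v = Asleep.
Proof. by rewrite /predicted => ->. Qed.

Variant predicted_spec r v : nstate -> Prop :=
  | PredAsleep of r <= t v : predicted_spec r v Asleep
  | PredActive p o of p < P & o < phase_length & r = t v + (p * phase_length + o).+1 :
      predicted_spec r v (Active (take (p * phase_length + o).+1 (trace P v)))
  | PredLast of r = t v + (P * phase_length).+1 : predicted_spec r v (Active (trace P v))
  | PredHalted of t v + (P * phase_length).+1 < r :
      predicted_spec r v (Halted (rcons (trace P v) HSilence)).

Lemma predictedP r v : predicted_spec r v (predicted r v).
Proof.
have L0 := phase_length_gt0 v; rewrite /predicted; case: leqP => h1; first exact: PredAsleep.
case: leqP => h2; last by apply: PredHalted; lia.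
have [E|i] := eqVneq (r - t v) (P * phase_length).+1.
  by rewrite E -(size_trace _ v) take_size; apply: PredLast; lia.
have dm := divn_eq (r - t v).-1 phase_length.
have E : r - t v = ((r - t v).-1 %/ phase_length * phase_length + (r - t v).-1 %% phase_length).+1.
  by rewrite -dm; lia.
rewrite E; apply: PredActive; rewrite ?ltn_mod //; last by lia.
by rewrite ltn_divLR //; lia.
Qed.

(** The clocks of [v] and [w] may be in different phases, but then [w] is silent: its slots stay
    [span t] away from both ends of a phase. *)
Lemma transmitted_phase p o v w : p < P -> o < phase_length ->
  transmitted D (predicted (t v + (p * phase_length + o).+1) w) =
  if slot p w + t w - t v == o then Some 0 else None.
Proof.
move=> pP oL; have [tv tw] := (tag_le_span v, tag_le_span w).
have sb p' := slot_bounds p' w; have sp := sb p.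
case: predictedP => [h|p' o' p'P o'L E|E|h] /=.
- by case: eqP => //; nia.
- rewrite canonical_action //; have sp' := sb p'; case: eqP => [oE|oE].
    have [|||<- E'] := @decode_block phase_length p' (slot p' w + t w - t v) p o; try lia.
    by rewrite E' eqxx.
  case: eqP => // E2; case: oE.
  by have [|||<- E'] := @decode_block phase_length p' o' p (slot p w); lia.
- by rewrite canonical_terminates; case: eqP => //; nia.
- by case: eqP => //; nia.
Qed.

(** Every slot is at least [span t], so nothing is sent while a node may still be asleep. *)
Lemma transmitted_early r w : r <= span t -> transmitted D (predicted r w) = None.
Proof.
move=> rs; case: predictedP => //= [p o pP oL E|_]; last by rewrite canonical_terminates.
by rewrite canonical_action //; case: eqP => // oE; have := slot_bounds p w; lia.
Qed.

Lemma canonical_run r v : states_before e t D r v = predicted r v.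
Proof.
elim: r v => [|r IH] v; first by rewrite predicted_asleep.
rewrite -[LHS]/(step e t D r (states_before e t D r) v) stepE IH.
rewrite (eq_heard (tx2 := fun w => transmitted D (predicted r w))); last first.
  by move=> w _; rewrite IH.
have sP : size (trace P v) = (P * phase_length).+1 := size_trace P v.
case: predictedP => [h|p o pP oL E|E|h] /=.
- rewrite h heard_silent => [|w _]; last first.
    by rewrite transmitted_early // (leq_trans h) ?tag_le_span.
  case: eqP => [->|ne]; last by rewrite predicted_asleep //; lia.
  by rewrite /predicted ltnn subSnn /= (take_trace v (leq0n P)).
- have -> : predicted r.+1 v = Active (rcons (take (p * phase_length + o).+1 (trace P v))
                                         (phase_entry (trace p) v o)).
    rewrite -(nth_trace v pP oL) -take_nth ?sP; last by nia.
    by rewrite /predicted E -addnS addKn ifF ?ifT //; nia.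
  rewrite canonical_action // /phase_entry -/(slot p v); case: eqP => // _.
  congr (Active (rcons _ _)); apply: eq_heard => w _.
  by rewrite E transmitted_phase.
- by rewrite canonical_terminates /predicted !ifF //; lia.
- by rewrite /predicted !ifF //; lia.
Qed.

Lemma canonical_final_history v h :
  final_history e t D v h <-> h = rcons (trace P v) HSilence.
Proof.
rewrite /final_history /states; split=> [[r]|->].
  by rewrite canonical_run; case: predictedP => // _ [].
by exists (t v + (P * phase_length).+1); rewrite canonical_run /predicted !ifF //; lia.
Qed.

End Run.

(** * Round bound and election *)

(* For span [0] the bound allows no phase at all; but then every phase conveys nothing. *)
Lemma exists_stable_phase : 0 < #|T| ->
  exists2 p, p * phase_length <= 3 * (#|T| ^ 2 * span t) &
    forall u v, trace p u = trace p v -> trace p.+1 u = trace p.+1 v.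
Proof.
move=> T0; case: (posnP (span t)) => s0; last first.
  have [p lp st] := stable_refinement trace_refine T0; exists p => //.
  (* The constant 3 comes from bounding [2 * span t + 1] by [3 * span t] for positive span. *)
  have -> : 3 * (#|T| ^ 2 * span t) = #|T| * (#|T| * (3 * span t)) by lia.
  by rewrite /phase_length /block_length !leq_mul ?(ltnW lp) //; lia.
exists 0 => // u v _; have t0 w : t w = 0 by have := tag_le_span w; lia.
congr cons; apply: eq_mkseq => o; rewrite /phase_entry /=.
case: eqP => // os; rewrite !heard_silent // => w _;
  by rewrite !t0 addn0 subn0; case: eqP => // E; case: os.
Qed.

End Canonical.

Theorem theorem1 :
  exists C : nat,
  forall (T : finType) (e : rel T) (t : T -> nat),
    configuration e t ->
    feasible e t ->
    exists (D : drip) (f : decision),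
      dedicated_LE e t D f /\
      forall (v : T) (h : seq hentry),
        final_history e t D v h ->
        done_round h <= C * (#|T| ^ 2 * span t) + C.
Proof.
exists 3 => T e t _ [D [f [_ [v0 [[h0 [fin0 f0]] uniq0]]]]].
have [|p time st] := @exists_stable_phase T e t; first by apply/card_gt0P; exists v0.
(* A node in the class of [v0] would share its final history under [D] and be elected too. *)
have lone u : trace e t p u = trace e t p v0 -> u = v0.
  move=> E; apply: uniq0; exists h0; split=> //.
  apply: final_history_invariance fin0; first exact: tag_le_span.
  - exact: (@slot_key_inj T e t p).
  - exact: trace_stable.
  - by rewrite /= E.
exists (canonical_drip e t p), (fun h => h == rcons (trace e t p v0) HSilence).
split; last first.
  move=> v h /canonical_final_history ->.
  (* The additive constant absorbs the round of termination. *)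
  by rewrite /done_round size_rcons size_trace /= -addn1 leq_add.
split=> [v|]; first by exists (rcons (trace e t p v) HSilence); apply/canonical_final_history.
exists v0; split.
  exists (rcons (trace e t p v0) HSilence).
  by split; [apply/canonical_final_history | rewrite eqxx].
by move=> u [h [/canonical_final_history -> /eqP/rcons_inj[/lone]]].
Qed.
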